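(* For all $n\geq 3$, $$B_{n}^{neobc}=35B_{n-1}^{neobc}-35B_{n-2}^{neobc}+B_{n-3}^{neobc},\quad C_{n}^{neobc}=35C_{n-1}^{neobc}-35C_{n-2}^{neobc}+C_{n-3}^{neobc},$$ $$R_{n}^{neobc}=35R_{n-1}^{neobc}-35R_{n-2}^{neobc}+R_{n-3}^{neobc},$$ and for all $n\geq 4$, $$CR_{n}^{neobc}=35CR_{n-1}^{neobc}-35CR_{n-2}^{neobc}+CR_{n-3}^{neobc}.$$
   Context: A positive integer $m$ is a neo balcobalancing number if there is a positive integer $r$ (its neo balcobalancer) such that $(1+2+\cdots+(m-1))+(1+2+\cdots+m)=2[(m-1)+m+(m+1)+(m+2)+\cdots+(m+r)]$; then $r=\frac{-2m-1+\sqrt{8m^2-12m+9}}{2}$ (equivalently, $m$ is a neo balcobalancing number iff $8m^2-12m+9$ is a perfect square). For $n\ge1$, $B_n^{neobc}$ denotes the $n$-th neo balcobalancing number in increasing order, $R_n^{neobc}$ its neo balcobalancer, $C_n^{neobc}=\sqrt{8(B_n^{neobc})^2-12B_n^{neobc}+9}$ and $CR_n^{neobc}=\sqrt{2(R_n^{neobc})^2+5R_n^{neobc}+2}$. By convention, $B_0^{neobc}=0$, $R_0^{neobc}=1$, $C_0^{neobc}=CR_0^{neobc}=3$. *)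

(* Defs.v *)
From HB Require Import structures.
From mathcomp Require Import all_boot all_order all_algebra zify.
From mathcomp Require Import boolp classical_sets reals.

Set Implicit Arguments.
Unset Strict Implicit.
Unset Printing Implicit Defensive.

Import Order.TTheory GRing.Theory Num.Theory.

Local Open Scope nat_scope.

(* [m.-1] is the genuine predecessor, since [m] is positive. *)
Definition neo_balcobalancer_of (m r : nat) : Prop :=
  [/\ 0 < m, 0 < r &
      \sum_(1 <= i < m) i + \sum_(1 <= i < m.+1) i
      = 2 * \sum_(m.-1 <= i < (m + r).+1) i].

Definition neo_balcobalancing (m : nat) : Prop :=
  exists r, neo_balcobalancer_of m r.

Lemma sum_iota2 k n : 2 * (\sum_(k <= i < k + n) i) + n = n * (2 * k + n).
Proof.
elim: n => [|n IHn]; first by rewrite addn0 big_geq //; lia.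
rewrite [k + _]addnS big_nat_recr ?leq_addr //=; nia.
Qed.

Lemma neo_balcobalancer_ofE m r :
  neo_balcobalancer_of m r <->
  [/\ 0 < m, 0 < r & m ^ 2 + r + 2 = (r + 2) * (2 * m + r)].
Proof.
rewrite /neo_balcobalancer_of.
case: m => [|m]; first by split=> -[].
have := sum_iota2 1 m; have := sum_iota2 1 m.+1; have := sum_iota2 m (r + 2).
rewrite /= !add1n.
rewrite (_ : m + (r + 2) = (m.+1 + r).+1); last by lia.
by move=> h1 h2 h3; split=> -[? ? ?]; split=> //; nia.
Qed.

(* The step (m, r) |-> (29 m + 12 r - 6, 12 m + 5 r - 4) is the action of the
   unit 17 + 12 sqrt 2 on (4 m - 3)^2 - 2 (2 r + 2 m + 1)^2 = - 9. *)
Lemma neo_balcobalancing_unbounded k :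
  exists m, `[< k < m /\ neo_balcobalancing m >].
Proof.
elim: k => [|k [m /asboolP[ltkm [r]]]].
  exists 6; apply/asboolP; split=> //; exists 1.
  by apply/neo_balcobalancer_ofE.
move=> /neo_balcobalancer_ofE[m0 r0 E]; exists (29 * m + 12 * r - 6).
apply/asboolP; split; first by lia.
exists (12 * m + 5 * r - 4); apply/neo_balcobalancer_ofE; split; nia.
Qed.

Fixpoint Bneobc (n : nat) : nat :=
  if n is n'.+1 then ex_minn (neo_balcobalancing_unbounded (Bneobc n')) else 0.

(* [xget 0] picks the neo balcobalancer, which exists and is unique by the
   lemmas below; the default 0 is never used. *)
Definition Rneobc (n : nat) : nat :=
  if n is 0 then 1 else xget 0 [set r | neo_balcobalancer_of (Bneobc n) r]%classic.

Lemma Bneobc_lt n : Bneobc n < Bneobc n.+1.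
Proof. by rewrite /=; case: ex_minnP => m /asboolP[]. Qed.

Lemma BneobcP n : neo_balcobalancing (Bneobc n.+1).
Proof. by rewrite /=; case: ex_minnP => m /asboolP[]. Qed.

Lemma Bneobc_surj m : neo_balcobalancing m -> exists n, m = Bneobc n.+1.
Proof.
move=> mP; have m0 : Bneobc 0 < m by case: mP => r [].
have ub : forall n, Bneobc n < m -> n <= m.
  suff le n : n <= Bneobc n by move=> n /ltnW; apply: leq_trans.
  by elim: n => // n /leq_ltn_trans; apply; apply: Bneobc_lt.
case: (@ex_maxnP (fun n => Bneobc n < m) m (ex_intro _ 0 m0) ub) => n ltn nmax; exists n.
apply/eqP; rewrite eqn_leq; apply/andP; split.
  by rewrite leqNgt; apply/negP => /nmax; rewrite ltnn.
by rewrite /=; case: ex_minnP => k _; apply; apply/asboolP.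
Qed.

Lemma neo_balcobalancer_of_inj m r s :
  neo_balcobalancer_of m r -> neo_balcobalancer_of m s -> r = s.
Proof.
by move=> /neo_balcobalancer_ofE[? ? ?] /neo_balcobalancer_ofE[? ? ?]; nia.
Qed.

Lemma RneobcP n : neo_balcobalancer_of (Bneobc n.+1) (Rneobc n.+1).
Proof.
by have [r rP] := BneobcP n; rewrite /Rneobc; case: xgetP => [_ _ //|/(_ r)].
Qed.

Local Open Scope ring_scope.

Definition Cneobc (R : realType) (n : nat) : R :=
  if n is 0%N then 3
  else Num.sqrt (8 * (Bneobc n)%:R ^+ 2 - 12 * (Bneobc n)%:R + 9).

Definition CRneobc (R : realType) (n : nat) : R :=
  if n is 0%N then 3
  else Num.sqrt (2 * (Rneobc n)%:R ^+ 2 + 5 * (Rneobc n)%:R + 2).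

(* Main.v *)
Require Import Defs.
From mathcomp Require Import zify ring lra.
From mathcomp Require Import all_boot all_order all_algebra.
From mathcomp Require Import reals.

Set Implicit Arguments.
Unset Strict Implicit.
Unset Printing Implicit Defensive.

Import Order.TTheory GRing.Theory Num.Theory.

Local Open Scope ring_scope.

(** The defining equation says that (4 m - 3)^2 + 9 = 2 (2 m + 2 r + 1)^2.
    Modulo 3 this forces 4 m - 3 = 3 x and 2 m + 2 r + 1 = 3 y, where (x, y)
    solves the negative Pell equation x^2 + 1 = 2 y^2. Its integer solutions
    with x >= -1 and y > 0 are the iterates (x_n, y_n) of (-1, 1) under
    (x, y) |-> (3 x + 4 y, 2 x + 3 y), and 4 m - 3 = 3 x is solvable in m
    exactly when x = 3 modulo 4, that is, at the even iterates. Comparing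
    increasing enumerations gives 4 B_n - 3 = 3 x_2n and
    2 B_n + 2 R_n + 1 = 3 y_2n, including at n = 0. Two iterations multiply
    x + y sqrt 2 by 17 + 12 sqrt 2, a root of X^2 - 34 X + 1, and the constant
    terms of these affine relations contribute the root 1, whence the
    coefficients of (X - 1) (X^2 - 34 X + 1). Finally C = 2 B + 2 R + 1 and
    CR = B - R - 2; the latter gives -3 instead of 3 at n = 0, which is why the
    recurrence for CR starts later. *)

Section IncreasingEnumerations.

Context {disp : Order.disp_t} {T : porderType disp}.
Implicit Types f g : nat -> T.

Lemma incn_sub_range_le f g :
    (forall n, (f n < f n.+1)%O) -> (forall n, (g n < g n.+1)%O) ->
    (forall i, exists j, f i = g j) ->
  forall n, (g n <= f n)%O.
Proof.
move=> incf /Order.NatMonotonyTheory.incnP gmono fg; elim=> [|n le_gf].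
  by have [j ->] := fg 0%N; rewrite gmono.
have [j fSn] := fg n.+1; rewrite fSn gmono.
suff: (g n < g j)%O by rewrite (leW_mono gmono).
by rewrite -fSn (le_lt_trans le_gf).
Qed.

Lemma incn_eq_range f g :
    (forall n, (f n < f n.+1)%O) -> (forall n, (g n < g n.+1)%O) ->
    (forall i, exists j, f i = g j) -> (forall j, exists i, g j = f i) ->
  f =1 g.
Proof.
by move=> incf incg fg gf n; apply/le_anti; rewrite !incn_sub_range_le.
Qed.

End IncreasingEnumerations.

Definition neg_pell (x y : int) : Prop := x ^+ 2 + 1 = 2 * y ^+ 2.

Fixpoint neg_pell_seq (n : nat) : int * int :=
  if n is n'.+1 then
    let: (x, y) := neg_pell_seq n' in (3 * x + 4 * y, 2 * x + 3 * y)
  else (-1, 1).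

Definition pellx (n : nat) : int := (neg_pell_seq n).1.
Definition pelly (n : nat) : int := (neg_pell_seq n).2.

Lemma pellxS n : pellx n.+1 = 3 * pellx n + 4 * pelly n.
Proof. by rewrite /pellx /pelly /=; case: neg_pell_seq. Qed.

Lemma pellyS n : pelly n.+1 = 2 * pellx n + 3 * pelly n.
Proof. by rewrite /pellx /pelly /=; case: neg_pell_seq. Qed.

Lemma neg_pell_seqP n : neg_pell (pellx n) (pelly n).
Proof.
rewrite /neg_pell; elim: n => // n IHn; rewrite pellxS pellyS; lia.
Qed.

Lemma pell_geN1_gt0 n : -1 <= pellx n /\ 0 < pelly n.
Proof. by elim: n => // n [x1 y0]; rewrite pellxS pellyS; lia. Qed.

Lemma pellx_lt n : pellx n < pellx n.+1.
Proof. by have [] := pell_geN1_gt0 n; rewrite pellxS; lia. Qed.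

Lemma neg_pell_descent x y : neg_pell x y -> 0 < x -> 0 < y ->
  [/\ neg_pell (3 * x - 4 * y) (3 * y - 2 * x), 0 < 3 * y - 2 * x,
      -1 <= 3 * x - 4 * y & 3 * x - 4 * y < x].
Proof.
rewrite /neg_pell => pell x0 y0.
have lt_2x_3y : 2 * x < 3 * y by rewrite -ltr_sqr ?nnegrE; lia.
have le_4y_3x : 4 * y <= 3 * x + 1 by rewrite -ler_sqr ?nnegrE; nia.
split; lia.
Qed.

Lemma neg_pell_complete x y : neg_pell x y -> -1 <= x -> 0 < y ->
  exists n, x = pellx n /\ y = pelly n.
Proof.
have [k] := ubnP `|(x + 1)%R|%N; elim: k x y => // k IHk x y ltk pell xge y0.
have [x_gt0|x_le0] := ltP 0 x.
  have [pell' y'0 x'ge ltx] := neg_pell_descent pell x_gt0 y0.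
  have [|n [xn yn]] := IHk _ _ _ pell' x'ge y'0; first by lia.
  by exists n.+1; rewrite pellxS pellyS -xn -yn; lia.
exists 0%N; rewrite /pellx /pelly /=; move: pell; rewrite /neg_pell; nia.
Qed.

Lemma pellx_doubleS n : pellx n.+1.*2 = 17 * pellx n.*2 + 24 * pelly n.*2.
Proof. by rewrite doubleS !(pellxS, pellyS); ring. Qed.

Lemma pelly_doubleS n : pelly n.+1.*2 = 12 * pellx n.*2 + 17 * pelly n.*2.
Proof. by rewrite doubleS !(pellxS, pellyS); ring. Qed.

Lemma pellx_double_lt n : pellx n.*2 < pellx n.+1.*2.
Proof. exact: lt_trans (pellx_lt _) (pellx_lt _). Qed.

(* The witnesses are those of m = 3 a, r = 3 b + 1. *)
Lemma pell_double_nat n :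
  exists a b : nat,
    pellx n.*2 = 4 * a%:Z - 1 /\ pelly n.*2 = 2 * (a + b)%:Z + 1.
Proof.
elim: n => [|n [a [b [xE yE]]]]; first by exists 0%N, 0%N.
exists (29 * a + 12 * b + 2)%N, (12 * a + 5 * b)%N.
by rewrite pellx_doubleS pelly_doubleS xE yE; lia.
Qed.

Lemma dvdz3_sum_sqr (x y : int) :
  (3 %| x ^+ 2 + y ^+ 2)%Z -> (3 %| x)%Z /\ (3 %| y)%Z.
Proof.
have mod3 (t : int) : exists q (s : 'I_3), t = 3 * q + s%:Z.
  exists (t %/ 3)%Z, (inord `|(t %% 3)%Z|).
  by rewrite inordK ?[LHS](divz_eq t 3); lia.
have [a [i ->]] := mod3 x; have [b [j ->]] := mod3 y; case/dvdzP => z.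
by case: i => -[|[|[|//]]] ? /=; case: j => -[|[|[|//]]] ? /=; lia.
Qed.

Definition neo_solution (m r : nat) : Prop :=
  (m ^ 2 + r + 2 = (r + 2) * (2 * m + r))%N.

Lemma neo_solution_balcobalancer_gt0 m r : neo_solution m r -> (0 < r)%N.
Proof.
by rewrite /neo_solution; case: r => // sol; case: m sol => [|[|[|[|m]]]]; nia.
Qed.

Lemma neo_solution_balcobalancer_le m r :
  (0 < m)%N -> neo_solution m r -> (r + 2 <= m)%N.
Proof. by rewrite /neo_solution; nia. Qed.

Lemma neo_solution_natr (A : pzRingType) m r : neo_solution m r ->
  m%:R ^+ 2 + r%:R + 2 = (r%:R + 2) * (2 * m%:R + r%:R) :> A.
Proof. by move=> sol; rewrite -!natrX -!natrM -!natrD -natrM sol. Qed.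

Lemma neo_balcobalancer_ofP m r :
  neo_balcobalancer_of m r <-> (0 < m)%N /\ neo_solution m r.
Proof.
rewrite neo_balcobalancer_ofE; split=> [[m0 _ sol] //|[m0 sol]].
by split=> //; apply: neo_solution_balcobalancer_gt0 sol.
Qed.

Lemma neo_solution_pell_eq m r :
  neo_solution m r <->
  (4 * m%:Z - 3) ^+ 2 + 9 = 2 * (2 * m%:Z + 2 * r%:Z + 1) ^+ 2.
Proof. by rewrite /neo_solution; split; lia. Qed.

Lemma neo_solutionP m r :
  neo_solution m r <-> exists n,
    4 * m%:Z - 3 = 3 * pellx n.*2 /\ 2 * m%:Z + 2 * r%:Z + 1 = 3 * pelly n.*2.
Proof.
rewrite neo_solution_pell_eq; split=> [sol|[n [-> ->]]]; last first.
  by have := neg_pell_seqP n.*2; rewrite /neg_pell; lia.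
have [|/dvdzP[x xE] /dvdzP[y yE]] :=
    @dvdz3_sum_sqr (4 * m%:Z - 3) (2 * m%:Z + 2 * r%:Z + 1).
  by apply/dvdzP; exists ((2 * m%:Z + 2 * r%:Z + 1) ^+ 2 - 3); lia.
have pell_xy : neg_pell x y by move: sol; rewrite xE yE /neg_pell; lia.
have [||n [xn yn]] := neg_pell_complete pell_xy; [lia|lia|].
have [n2|n2] : n = n./2.*2 \/ n = n./2.*2.+1 by lia.
  by exists n./2; rewrite -n2 -xn -yn; lia.
have [a [b [xa yb]]] := pell_double_nat n./2.
by move: xn; rewrite n2 pellxS xa yb; lia.
Qed.

Lemma neobc_solution n : neo_solution (Bneobc n) (Rneobc n).
Proof.
by case: n => // n; have [] := (neo_balcobalancer_ofP _ _).1 (RneobcP n).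
Qed.

Lemma neo_solution_Bneobc m r : neo_solution m r -> exists n, m = Bneobc n.
Proof.
move=> sol; have [->|m0] := posnP m; first by exists 0%N.
have [|n ->] := @Bneobc_surj m; last by exists n.+1.
by exists r; apply/neo_balcobalancer_ofP.
Qed.

Lemma Bneobc_pellx n : 4 * (Bneobc n)%:Z - 3 = 3 * pellx n.*2.
Proof.
apply: (@incn_eq_range _ _ (fun k => 4 * (Bneobc k)%:Z - 3)
                           (fun k => 3 * pellx k.*2)) => k.
- by have := Bneobc_lt k; lia.
- by have := pellx_double_lt k; lia.
- by have [j [Bj _]] := (neo_solutionP _ _).1 (neobc_solution k); exists j.
have [a [b [xa yb]]] := pell_double_nat k.
have sol : neo_solution (3 * a) (3 * b + 1).
  by apply/neo_solutionP; exists k; rewrite xa yb; lia.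
by have [i Bi] := neo_solution_Bneobc sol; exists i; rewrite -Bi xa; lia.
Qed.

Lemma neobc_pelly n :
  2 * (Bneobc n)%:Z + 2 * (Rneobc n)%:Z + 1 = 3 * pelly n.*2.
Proof.
have [k [Bk BRk]] := (neo_solutionP _ _).1 (neobc_solution n).
have pell_n := neg_pell_seqP n.*2; have pell_k := neg_pell_seqP k.*2.
have [_ yn0] := pell_geN1_gt0 n.*2.
have [_ yk0] := pell_geN1_gt0 k.*2.
have xkn : pellx k.*2 = pellx n.*2 by have := Bneobc_pellx n; lia.
have ykn2 : pelly k.*2 ^+ 2 = pelly n.*2 ^+ 2.
  by move: pell_n pell_k; rewrite /neg_pell xkn; lia.
by move/eqP: ykn2; rewrite BRk eqrXn2 ?ltW // => /eqP ->.
Qed.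

Lemma CneobcE (R : realType) n :
  Cneobc R n = (2 * (Bneobc n)%:Z + 2 * (Rneobc n)%:Z + 1)%:~R.
Proof.
case: n => [//|n].
have sol := neo_solution_natr R (neobc_solution n.+1).
rewrite /Cneobc; set b : R := (Bneobc n.+1)%:R; set r : R := (Rneobc n.+1)%:R.
have -> : 8 * b ^+ 2 - 12 * b + 9 = (2 * b + 2 * r + 1) ^+ 2.
  by move: sol; rewrite -/b -/r; lra.
by rewrite sqrtr_sqr ger0_norm ?addr_ge0 ?mulr_ge0 // !(intrD, intrM).
Qed.

Lemma CRneobcE (R : realType) n :
  CRneobc R n.+1 = ((Bneobc n.+1)%:Z - (Rneobc n.+1)%:Z - 2)%:~R.
Proof.
have sol := neo_solution_natr R (neobc_solution n.+1).
rewrite /CRneobc; set r : R := (Rneobc n.+1)%:R; set b : R := (Bneobc n.+1)%:R.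
have -> : 2 * r ^+ 2 + 5 * r + 2 = (b - r - 2) ^+ 2.
  by move: sol; rewrite -/b -/r; lra.
have B0 : (0 < Bneobc n.+1)%N by have := Bneobc_lt n; lia.
rewrite sqrtr_sqr ger0_norm ?intrB //.
have := neo_solution_balcobalancer_le B0 (neobc_solution n.+1).
by rewrite -(ler_nat R) natrD -/b -/r; lra.
Qed.

Definition rec35 (A : pzRingType) (s : nat -> A) : Prop :=
  forall n, s n.+3 = 35 * s n.+2 - 35 * s n.+1 + s n.

Lemma rec35_intr (A : pzRingType) (s : nat -> int) :
  rec35 s -> rec35 (fun n => (s n)%:~R : A).
Proof. by move=> rec_s n; rewrite rec_s !(intrD, intrN, intrM). Qed.

Lemma rec35_pellx_double : rec35 (fun n => pellx n.*2).
Proof. by move=> n; rewrite !(pellx_doubleS, pelly_doubleS); ring. Qed.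

Lemma rec35_pelly_double : rec35 (fun n => pelly n.*2).
Proof. by move=> n; rewrite !(pellx_doubleS, pelly_doubleS); ring. Qed.

Lemma rec35_Bneobc : rec35 (fun n => (Bneobc n)%:Z).
Proof.
move=> n; have := rec35_pellx_double n.
have := Bneobc_pellx n; have := Bneobc_pellx n.+1.
have := Bneobc_pellx n.+2; have := Bneobc_pellx n.+3; lia.
Qed.

Lemma rec35_Rneobc : rec35 (fun n => (Rneobc n)%:Z).
Proof.
move=> n; have := rec35_Bneobc n; have := rec35_pelly_double n.
have := neobc_pelly n; have := neobc_pelly n.+1.
have := neobc_pelly n.+2; have := neobc_pelly n.+3; lia.
Qed.

Lemma rec35_Cneobc (R : realType) : rec35 (Cneobc R).
Proof.
move=> n; rewrite !CneobcE.
apply: (@rec35_intr R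
  (fun k => 2 * (Bneobc k)%:Z + 2 * (Rneobc k)%:Z + 1)) => k.
by rewrite rec35_Bneobc rec35_Rneobc; ring.
Qed.

Lemma rec35_CRneobc (R : realType) : rec35 (fun n => CRneobc R n.+1).
Proof.
move=> n; rewrite !CRneobcE.
apply: (@rec35_intr R
  (fun k => (Bneobc k.+1)%:Z - (Rneobc k.+1)%:Z - 2)) => k.
by rewrite rec35_Bneobc rec35_Rneobc; ring.
Qed.

Theorem theorem3p2 (R : realType) :
  (forall n : nat, (3 <= n)%N ->
     [/\ (Bneobc n)%:Z = 35 * (Bneobc (n - 1))%:Z - 35 * (Bneobc (n - 2))%:Z
                         + (Bneobc (n - 3))%:Z,
         Cneobc R n = 35 * Cneobc R (n - 1) - 35 * Cneobc R (n - 2)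
                      + Cneobc R (n - 3)
       & (Rneobc n)%:Z = 35 * (Rneobc (n - 1))%:Z - 35 * (Rneobc (n - 2))%:Z
                         + (Rneobc (n - 3))%:Z]) /\
  (forall n : nat, (4 <= n)%N ->
     CRneobc R n = 35 * CRneobc R (n - 1) - 35 * CRneobc R (n - 2)
                   + CRneobc R (n - 3)).
Proof.
split=> [[|[|[|n]]] // _|[|[|[|[|n]]]] // _]; rewrite !subSS !subn0.
  split; [exact: rec35_Bneobc | exact: rec35_Cneobc | exact: rec35_Rneobc].
exact: rec35_CRneobc.
Qed.
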